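(* Let the matrices $A_1, A_3, D_1, D_2, E$ and the data $(U_-, X_{1-}, X_2)$ be given, with the set $\Sigma_{\mathcal{D}}$ of compatible endosystems containing the true endosystem $(A_{2s},B_{2s})$. Assume that $A_1$ is anti-stable and diagonalizable. Then the data $(U_-,X_{1-},X_2)$ are informative for regulator design if and only if at least one of the following two conditions holds: 1) $X_{2-}$ has full row rank, and there exists a right-inverse $X_{2-}^\dagger$ of $X_{2-}$ such that $(X_{2+} - A_3 X_{1-}) X_{2-}^\dagger$ is stable and $D_2 + E U_- X_{2-}^\dagger = 0$. Moreover, $\operatorname{im} D_1 \subseteq \operatorname{im} E$. 2) $X_{2-}$ has full row rank, and there exists a right-inverse $X_{2-}^\dagger$ of $X_{2-}$ such that $(X_{2+} - A_3 X_{1-}) X_{2-}^\dagger$ is stable. Moreover, there exists a real $\tau \times n_1$ matrix $W$ satisfying the linear equations $$X_{2-} W A_1 - (X_{2+} - A_3 X_{1-}) W = A_3, \qquad D_1 + (D_2 X_{2-} + E U_-) W = 0.$$ Furthermore, if condition 1) holds with right-inverse $X_{2-}^\dagger$, then for any $K_1$ such that $D_1 + E K_1 = 0$ and for $K_2 := U_- X_{2-}^\dagger$, the control law $u(t) = K_1 x_1(t) + K_2 x_2(t)$ is a regulator for every endosystem with $(A_2,B_2) \in \Sigma_{\mathcal{D}}$. If condition 2) holds with right-inverse $X_{2-}^\dagger$ and solution $W$, then for $K_1 := U_- (I - X_{2-}^\dagger X_{2-}) W$ and $K_2 := U_- X_{2-}^\dagger$, the control law $u(t) = K_1 x_1(t)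 + K_2 x_2(t)$ is a regulator for every endosystem with $(A_2,B_2) \in \Sigma_{\mathcal{D}}$.
   Context: All matrices are real. A square matrix is called stable if all its (complex) eigenvalues lie in the open unit disk, and anti-stable if all its eigenvalues $\lambda$ satisfy $|\lambda| \geq 1$. Diagonalizable means diagonalizable over $\mathbb{C}$. $\operatorname{im} M$ denotes the image of a matrix $M$. For a matrix $X$, the symbol $X^\dagger$ denotes some right-inverse of $X$, i.e. a matrix with $X X^\dagger = I$ (not necessarily the Moore-Penrose inverse). Systems. Time is discrete, $t = 0,1,2,\ldots$. The exosystem is $x_1(t+1) = A_1 x_1(t)$ with $x_1(t) \in \mathbb{R}^{n_1}$. An endosystem with system matrices $(A_2,B_2)$, where $A_2 \in \mathbb{R}^{n_2 \times n_2}$ and $B_2 \in \mathbb{R}^{n_2 \times m}$, is $x_2(t+1) = A_2 x_2(t) + B_2 u(t) + A_3 x_1(t)$ with $x_2(t) \in \mathbb{R}^{n_2}$, $u(t) \in \mathbb{R}^m$. The output to be regulated is $z(t) = D_1 x_1(t) + D_2 x_2(t) + E u(t) \in \mathbb{R}^p$. The matrices $A_1 \in \mathbb{R}^{n_1\times n_1}$, $A_3 \in \mathbb{R}^{n_2 \times n_1}$, $D_1 \in \mathbb{R}^{p\times n_1}$, $D_2 \in \mathbb{R}^{p\times n_2}$, $E \in \mathbb{R}^{p \times m}$ are known. The true endosystem has unknown matrices $(A_{2s},B_{2s})$. Regulators. Given $K_1 \in \mathbb{R}^{m\times n_1}$, $K_2 \in \mathbb{R}^{m \times n_2}$, interconnecting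 the endosystem $(A_2,B_2)$ with $u(t) = K_1 x_1(t) + K_2 x_2(t)$ gives the controlled system $$x_1(t+1) = A_1 x_1(t), \quad x_2(t+1) = (A_3 + B_2 K_1) x_1(t) + (A_2 + B_2 K_2) x_2(t), \quad z(t) = (D_1 + E K_1) x_1(t) + (D_2 + E K_2) x_2(t).$$ It is called endo-stable if $A_2 + B_2 K_2$ is stable, and output regulated if $z(t) \to 0$ as $t \to \infty$ for all initial states $x_1(0), x_2(0)$. The control law is a regulator for the endosystem $(A_2,B_2)$ if the controlled system is both endo-stable and output regulated. Data. For a positive integer $\tau$, the data are finite sequences of samples of the input, of the exosystem state, and of the endosystem state: $$U_- = [u(0)\ \cdots\ u(\tau-1)], \quad X_{1-} = [x_1(0)\ \cdots\ x_1(\tau-1)], \quad X_2 = [x_2(0)\ \cdots\ x_2(\tau)],$$ and one denotes $X_{2-} = [x_2(0)\ \cdots\ x_2(\tau-1)]$, $X_{2+} = [x_2(1)\ \cdots\ x_2(\tau)]$. The set of endosystems compatible with the data is $$\Sigma_{\mathcal{D}} = \{ (A_2,B_2) \mid X_{2+} = A_2 X_{2-} + A_3 X_{1-} + B_2 U_- \}.$$ Standing assumption: the true endosystem $(A_{2s},B_{2s})$ belongs to $\Sigma_{\mathcal{D}}$ (in particular $\Sigma_{\mathcal{D}}$ is nonempty). Informativity. The data $(U_-,X_{1-},X_2)$ are informative for regulator design if there exist $K_1$ and $K_2$ such that the control law $u(t) = K_1 x_1(t) + K_2 x_2(t)$ is a regulator for every endosystem with $(A_2,B_2) \in \Sigma_{\mathcal{D}}$.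 *)

(* Defs.v *)
From HB Require Import structures.
From mathcomp Require Export all_boot all_order all_algebra.
From mathcomp Require Export all_classical all_reals all_analysis.
From mathcomp Require Export complex.

Set Implicit Arguments.
Unset Strict Implicit.
Unset Printing Implicit Defensive.

Import Order.TTheory GRing.Theory Num.Theory.
Import numFieldNormedType.Exports.
Local Open Scope classical_set_scope.
Local Open Scope ring_scope.

Definition complexify (R : realType) m n (M : 'M[R]_(m, n)) : 'M[R[i]]_(m, n) :=
  map_mx (real_complex R) M.

(* The moduli below are taken in R[i], whose partial order restricts to the
   usual order on the reals.  [eigenvalue] is phrased with row eigenvectors,
   which gives the same spectrum as column eigenvectors. *)
Definition stable (R : realType) n (M : 'M[R]_n) : Prop :=
  forall l : R[i], eigenvalue (complexify M) l -> `|l| < 1.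

Definition anti_stable (R : realType) n (M : 'M[R]_n) : Prop :=
  forall l : R[i], eigenvalue (complexify M) l -> 1 <= `|l|.

Definition diagonalizable_over_C (R : realType) n (M : 'M[R]_n) : Prop :=
  diagonalizable (complexify M).

(* Column image; the row-space operations of mxalgebra are not used here. *)
Definition im (R : realType) m n (M : 'M[R]_(m, n)) : set 'cV[R]_m :=
  range (fun v : 'cV[R]_n => M *m v).

Definition full_row_rank (R : realType) m n (M : 'M[R]_(m, n)) : Prop :=
  \rank M = m.

Definition right_inverse (R : realType) m n
    (X : 'M[R]_(m, n)) (Xd : 'M[R]_(n, m)) : Prop :=
  X *m Xd = 1%:M.

Definition past (R : realType) n tau (X : 'M[R]_(n, tau.+1)) : 'M[R]_(n, tau) :=
  \matrix_(i, t) X i (widen_ord (leqnSn tau) t).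

Definition future (R : realType) n tau (X : 'M[R]_(n, tau.+1)) : 'M[R]_(n, tau) :=
  \matrix_(i, t) X i (lift ord0 t).

Definition compatible_systems (R : realType) (n1 n2 m tau : nat)
    (A3 : 'M[R]_(n2, n1)) (U : 'M[R]_(m, tau)) (X1 : 'M[R]_(n1, tau))
    (X2 : 'M[R]_(n2, tau.+1)) : set ('M[R]_n2 * 'M[R]_(n2, m)) :=
  [set S | future X2 = S.1 *m past X2 + A3 *m X1 + S.2 *m U].

Definition controlled_trajectory (R : realType) (n1 n2 m : nat)
    (A1 : 'M[R]_n1) (A3 : 'M[R]_(n2, n1))
    (A2 : 'M[R]_n2) (B2 : 'M[R]_(n2, m))
    (K1 : 'M[R]_(m, n1)) (K2 : 'M[R]_(m, n2))
    (x1 : nat -> 'cV[R]_n1) (x2 : nat -> 'cV[R]_n2) : Prop :=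
  forall t : nat,
    x1 t.+1 = A1 *m x1 t /\
    x2 t.+1 = (A3 + B2 *m K1) *m x1 t + (A2 + B2 *m K2) *m x2 t.

Definition endo_stable (R : realType) (n2 m : nat)
    (A2 : 'M[R]_n2) (B2 : 'M[R]_(n2, m)) (K2 : 'M[R]_(m, n2)) : Prop :=
  stable (A2 + B2 *m K2).

(* A trajectory is determined by its initial states x1 0 and x2 0, which are
   arbitrary. *)
Definition output_regulated (R : realType) (n1 n2 m p : nat)
    (A1 : 'M[R]_n1) (A3 : 'M[R]_(n2, n1))
    (D1 : 'M[R]_(p, n1)) (D2 : 'M[R]_(p, n2)) (E : 'M[R]_(p, m))
    (A2 : 'M[R]_n2) (B2 : 'M[R]_(n2, m))
    (K1 : 'M[R]_(m, n1)) (K2 : 'M[R]_(m, n2)) : Prop :=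
  forall (x1 : nat -> 'cV[R]_n1) (x2 : nat -> 'cV[R]_n2),
    controlled_trajectory A1 A3 A2 B2 K1 K2 x1 x2 ->
    (fun t : nat => (D1 + E *m K1) *m x1 t + (D2 + E *m K2) *m x2 t)
      @ \oo --> (0 : 'cV[R]_p).

Definition regulator (R : realType) (n1 n2 m p : nat)
    (A1 : 'M[R]_n1) (A3 : 'M[R]_(n2, n1))
    (D1 : 'M[R]_(p, n1)) (D2 : 'M[R]_(p, n2)) (E : 'M[R]_(p, m))
    (K1 : 'M[R]_(m, n1)) (K2 : 'M[R]_(m, n2))
    (S : 'M[R]_n2 * 'M[R]_(n2, m)) : Prop :=
  endo_stable S.1 S.2 K2 /\ output_regulated A1 A3 D1 D2 E S.1 S.2 K1 K2.

Definition informative (R : realType) (n1 n2 m p tau : nat)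
    (A1 : 'M[R]_n1) (A3 : 'M[R]_(n2, n1))
    (D1 : 'M[R]_(p, n1)) (D2 : 'M[R]_(p, n2)) (E : 'M[R]_(p, m))
    (U : 'M[R]_(m, tau)) (X1 : 'M[R]_(n1, tau)) (X2 : 'M[R]_(n2, tau.+1)) : Prop :=
  exists (K1 : 'M[R]_(m, n1)) (K2 : 'M[R]_(m, n2)),
    forall S, compatible_systems A3 U X1 X2 S -> regulator A1 A3 D1 D2 E K1 K2 S.

Definition condition1_with (R : realType) (n1 n2 m p tau : nat)
    (A3 : 'M[R]_(n2, n1))
    (D1 : 'M[R]_(p, n1)) (D2 : 'M[R]_(p, n2)) (E : 'M[R]_(p, m))
    (U : 'M[R]_(m, tau)) (X1 : 'M[R]_(n1, tau)) (X2 : 'M[R]_(n2, tau.+1))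
    (Xd : 'M[R]_(tau, n2)) : Prop :=
  [/\ full_row_rank (past X2),
      right_inverse (past X2) Xd,
      stable ((future X2 - A3 *m X1) *m Xd),
      D2 + E *m U *m Xd = 0
    & im D1 `<=` im E].

Definition condition2_with (R : realType) (n1 n2 m p tau : nat)
    (A1 : 'M[R]_n1) (A3 : 'M[R]_(n2, n1))
    (D1 : 'M[R]_(p, n1)) (D2 : 'M[R]_(p, n2)) (E : 'M[R]_(p, m))
    (U : 'M[R]_(m, tau)) (X1 : 'M[R]_(n1, tau)) (X2 : 'M[R]_(n2, tau.+1))
    (Xd : 'M[R]_(tau, n2)) (W : 'M[R]_(tau, n1)) : Prop :=
  [/\ full_row_rank (past X2),
      right_inverse (past X2) Xd,
      stable ((future X2 - A3 *m X1) *m Xd),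
      past X2 *m W *m A1 - (future X2 - A3 *m X1) *m W = A3
    & D1 + (D2 *m past X2 + E *m U) *m W = 0].

(* Main.v *)
(* Write P = X_{2-} and F = X_{2+} - A_3 X_{1-}, so that the compatible systems are
   the solutions of F = A_2 P + B_2 U.  A regulator stabilizes all of them, and
   the trace of a stable matrix is bounded, so the closed loop A_2 + B_2 K_2 cannot
   move along this affine family; this forces K_2 = U Xd for a right inverse Xd of P
   and makes the closed loop the same matrix M = F Xd for every compatible system.
   As M and A_1 share no eigenvalue, the Sylvester equation
   V A_1 - M V = A_3 + B_2 K_1 has a solution V, and regulation means
   D_1 + E K_1 + G V = 0 with G = D_2 + E K_2, for every compatible B_2.
   Varying B_2 by rank-one terms b h with h (U - K_2 P) = 0 shows that either G = 0,
   which is condition 1, or h K_1 = 0 for all such h, so that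
   K_1 = (U - K_2 P) Y for some Y; then W = Xd V + (1 - Xd P) Y gives condition 2.
   Conversely, under condition 2 the matrix V = P W solves the Sylvester equation
   for every compatible system, x_2 - V x_1 evolves under the stable matrix M, and
   z = G (x_2 - V x_1). *)
Require Import Defs.
From mathcomp Require Import all_boot all_order all_algebra.
From mathcomp Require Import all_classical all_reals all_analysis.
From mathcomp Require Import lra.

Set Implicit Arguments.
Unset Strict Implicit.
Unset Printing Implicit Defensive.

Import Order.TTheory GRing.Theory Num.Theory.
Import numFieldNormedType.Exports.
Local Open Scope classical_set_scope.
Local Open Scope ring_scope.

(** * Preliminaries: linear solvability, scalar convergence, complex moduli *)

Lemma mulmx_solvable (F : fieldType) m n p (A : 'M[F]_(m, n)) (B : 'M[F]_(m, p)) :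
  (forall h : 'rV[F]_m, h *m A = 0 -> h *m B = 0) ->
  exists Y : 'M[F]_(n, p), B = A *m Y.
Proof.
move=> kerAB.
(* Transposition turns column-space inclusion into row-space inclusion; the transposed columns of
   [cokermx A^T] annihilate [A] from the left. *)
have /submxP[Y BAY] : (B^T <= A^T)%MS.
  rewrite submxE -trmx_eq0 trmx_mul trmxK; apply/eqP/row_matrixP => i.
  rewrite row_mul row0; apply: kerAB; rewrite -row_mul.
  by rewrite -[A in _ *m A]trmxK -trmx_mul mulmx_coker trmx0 row0.
by exists Y^T; rewrite -[B]trmxK BAY trmx_mul trmxK.
Qed.

Lemma cvg_col0P (R : realType) p (z : nat -> 'cV[R]_p) :
  z @ \oo --> (0 : 'cV[R]_p) <->
  forall i, (fun t => z t i 0) @ \oo --> (0 : R).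
Proof.
split=> [z0 i|z0].
  apply/cvgrPdist_lt => e e0.
  have /cvg_ballP/(_ e e0) := z0; apply: filterS => t /= [_ /(_ i 0)].
  by rewrite !mxE.
apply/cvg_ballP => e e0.
have : \forall t \near \oo, forall i, `|z t i 0| < e.
  apply: filter_forall => i.
  by have /cvgr0Pnorm_lt/(_ e e0) := z0 i.
apply: filterS => t zt; split=> // i j.
by rewrite ord1 !mxE /ball /= sub0r normrN.
Qed.

Lemma cvg0_recurrence (R : realType) (r : R) (a b : nat -> R) :
  0 <= r < 1 -> (forall t, 0 <= a t) ->
  (forall t, a t.+1 <= r * a t + b t) ->
  b @ \oo --> (0 : R) -> a @ \oo --> (0 : R).
Proof.
move=> /andP[r0 r1] a0 arec b0; apply/cvgr0Pnorm_lt => e e0.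
(* With this constant [c], the map [x -> r x + c] has fixed point [e / 2]; the other half of [e] is
   left for the geometric term. *)
have c0 : 0 < e / 2 * (1 - r) by rewrite mulr_gt0 ?divr_gt0 ?subr_gt0.
have /cvgr0Pnorm_lt/(_ _ c0)[N _ bN] := b0.
have bound k : a (k + N)%N <= r ^+ k * a N + e / 2.
  elim: k => [|k IHk]; first by rewrite expr0 mul1r lerDl divr_ge0 ?ltW.
  have bk := ltW (le_lt_trans (ler_norm _) (bN (k + N)%N (leq_addl _ _))).
  rewrite addSn (le_trans (arec _))// exprS.
  have := ler_wpM2l r0 IHk; lra.
have /cvgr0Pnorm_lt/(_ (e / 2))[|K _ rK] : geometric (a N) r @ \oo --> (0 : R).
- by apply: cvg_geometric; rewrite ger0_norm.
- by rewrite divr_gt0.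
exists (K + N)%N => // t /= KNt.
have Nt : (N <= t)%N by rewrite (leq_trans _ KNt) ?leq_addl.
have Kt : (K <= t - N)%N by rewrite leq_subRL// addnC.
have := bound (t - N)%N; have := le_lt_trans (ler_norm _) (rK _ Kt).
rewrite /geometric /= subnK// ger0_norm// mulrC; lra.
Qed.

(** Real-valued, so that limits and order live in [R] rather than in the partially ordered
    [R[i]]. *)
Definition cmod (R : realType) (z : R[i]) : R := complex.Re `|z|.

Lemma cmodE (R : realType) (z : R[i]) : (cmod z)%:C%C = `|z|.
Proof. by rewrite /cmod RRe_real// normr_real. Qed.

Lemma cmod_ge0 (R : realType) (z : R[i]) : 0 <= cmod z.
Proof. by rewrite -lecR cmodE normr_ge0. Qed.

Lemma cmod0_eq (R : realType) (z : R[i]) : cmod z = 0 -> z = 0.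
Proof. by move=> z0; apply/normr0_eq0; rewrite -cmodE z0. Qed.

Lemma cmod0 (R : realType) : cmod (0 : R[i]) = 0.
Proof. by rewrite /cmod normr0. Qed.

Lemma cmodD (R : realType) (y z : R[i]) : cmod (y + z) <= cmod y + cmod z.
Proof. by rewrite -lecR rmorphD /= !cmodE ler_normD. Qed.

Lemma cmodM (R : realType) (y z : R[i]) : cmod (y * z) = cmod y * cmod z.
Proof.
apply: (@complexI R); rewrite rmorphM /= !cmodE.
exact: normrM.
Qed.

Lemma cmod_real (R : realType) (x : R) : cmod x%:C%C = `|x|.
Proof.
by apply: (@complexI R); rewrite cmodE normc_def /= expr0n addr0 sqrtr_sqr.
Qed.

Lemma cmod_lt1 (R : realType) (z : R[i]) : (`|z| < 1) = (cmod z < 1).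
Proof. by rewrite -cmodE -ltcR. Qed.

Lemma cmod_ge1 (R : realType) (z : R[i]) : (1 <= `|z|) = (1 <= cmod z).
Proof. by rewrite -cmodE -lecR. Qed.

Lemma cmod_cvg0_recurrence (R : realType) (l : R[i]) (y : nat -> R[i]) :
  `|l| < 1 ->
  (fun t => cmod (y t.+1 - l * y t)) @ \oo --> (0 : R) ->
  (fun t => cmod (y t)) @ \oo --> (0 : R).
Proof.
move=> l1 yl; apply: (cvg0_recurrence (r := cmod l)) yl.
- by rewrite cmod_ge0 -cmod_lt1.
- by move=> t; exact: cmod_ge0.
- by move=> t; rewrite -cmodM addrC -{1}[y t.+1](subrK (l * y t)) cmodD.
Qed.

(** * Stable matrices: decay of trajectories and trace bound *)

Lemma complexify_root_factors (R : realType) n (M : 'M[R]_n) : stable M ->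
  exists2 s : seq R[i], char_poly (complexify M) = \prod_(l <- s) ('X - l%:P) &
    forall l, l \in s -> `|l| < 1.
Proof.
move=> stM; have [s] := closed_field_poly_normal (char_poly (complexify M)).
rewrite (monicP (char_poly_monic _)) scale1r => chars; exists s => // l ls.
by apply: stM; rewrite eigenvalue_root_char chars root_prod_XsubC.
Qed.

(* By Cayley-Hamilton the product of all factors M - l annihilates y; the
   factors are peeled off one at a time, each costing a scalar recurrence. *)
Lemma stable_trajectory_cvg0 (R : realType) n (M : 'M[R]_n) (e : nat -> 'cV[R]_n) :
  stable M -> (forall t, e t.+1 = M *m e t) ->
  forall i, (fun t => e t i 0) @ \oo --> (0 : R).
Proof.
case: n M e => [M e _ _ []//|n M e stM erec i].
have [s chars s1] := complexify_root_factors stM.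
set Mc := complexify M in chars.
suff peel r (y : nat -> 'cV[R[i]]_n.+1) : (forall l, l \in r -> `|l| < 1) ->
    (forall t, y t.+1 = Mc *m y t) ->
    (forall t, horner_mx Mc (\prod_(l <- r) ('X - l%:P)) *m y t = 0) ->
    forall j, (fun t => cmod (y t j 0)) @ \oo --> (0 : R).
  apply/norm_cvg0P.
  have -> : (fun t => `|e t i 0|) = fun t => cmod (complexify (e t) i 0).
    by apply/funext => t; rewrite mxE cmod_real.
  apply: (peel s) => // t; first by rewrite erec /complexify map_mxM.
  by rewrite -chars Cayley_Hamilton mul0mx.
elim: r y => [|l r IHr] y r1 yrec yr j.
  have -> : (fun t => cmod (y t j 0)) = cst (0 : R).
    by apply/funext => t; have := yr t; rewrite big_nil rmorph1 mul1mx => ->;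
      rewrite mxE cmod0.
  exact: cvg_cst.
apply: (cmod_cvg0_recurrence (r1 l (mem_head l r))).
have -> : (fun t => cmod (y t.+1 j 0 - l * y t j 0)) =
    (fun t => cmod ((y t.+1 - l *: y t) j 0)).
  by apply/funext => t; rewrite !mxE.
(* The sequence [y t.+1 - l *: y t] is again a trajectory of [Mc], annihilated by the remaining
   factors. *)
apply: IHr => [k kr|t|t].
- by apply: r1; rewrite in_cons kr orbT.
- by rewrite !yrec mulmxBr scalemxAr.
- have := yr t; rewrite big_cons mulrC rmorphM /= rmorphB /= horner_mx_X horner_mx_C.
  by rewrite -[_ * _]/(_ *m _) -mulmxA mulmxBl mul_scalar_mx -yrec.
Qed.

(** The trace is the sum of the complex eigenvalues with multiplicity, each of modulus below 1. *)
Lemma stable_norm_trace (R : realType) n (M : 'M[R]_n) :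
  stable M -> `|\tr M| <= n%:R.
Proof.
case: n M => [M _|n M stM]; first by rewrite /mxtrace big_ord0 normr0.
have [s chars s1] := complexify_root_factors stM.
have sizes : size s = n.+1.
  by apply: succn_inj; rewrite -(size_prod_XsubC s id) -chars size_char_poly.
have trs : \tr (complexify M) = \sum_(l <- s) l.
  have := char_poly_trace (complexify M) (ltn0Sn n).
  by rewrite chars -{1}sizes coefPn_prod_XsubC ?sizes// => /oppr_inj.
have {}trs : (\tr M)%:C%C = \sum_(l <- s) l by rewrite -trs /complexify trace_map_mx.
rewrite -cmod_real -lecR cmodE trs (le_trans (ler_norm_sum _ _ _))//.
rewrite rmorph_nat -sizes -sum1_size natr_sum big_seq [leRHS]big_seq.
by apply: ler_sum => l /s1/ltW.
Qed.

Lemma stable_sub_scalar_unit (R : realType) n (M : 'M[R]_n) (l : R[i]) :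
  stable M -> 1 <= `|l| -> complexify M - l%:M \in unitmx.
Proof.
move=> stM l1; rewrite -row_free_unit -kermx_eq0; apply/negPn/negP => ev.
by have := le_lt_trans l1 (stM l ev); rewrite ltxx.
Qed.

(** * Anti-stable modes and Sylvester equations *)

Lemma anti_stable_eigenbasis (R : realType) n (A : 'M[R]_n) :
  anti_stable A -> diagonalizable_over_C A ->
  exists (Q : 'M[R[i]]_n) (d : 'I_n -> R[i]),
    [/\ Q \in unitmx, forall j, complexify A *m col j Q = d j *: col j Q
      & forall j, 1 <= `|d j|].
Proof.
move=> asA [P Punit /(similar_diagLR Punit)[D]].
rewrite conjVmx// => AD.
exists (invmx P), (fun j => D 0 j); split=> [|j|j].
- by rewrite unitmx_inv.
- rewrite AD colE mulmxA mulmxK// -!colE.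
  by rewrite mul_mx_diag; apply/colP => i; rewrite !mxE mulrC.
(* [eigenvalue] asks for row eigenvectors: these are the rows of [P], while the columns of its
   inverse are the column eigenvectors. *)
apply: asA; apply/eigenvalueP; exists (row j P).
  by rewrite AD -row_mul -mulmxA mulKVmx// row_mul row_diag_mx -scalemxAl -rowE.
apply: contraTneq isT => rowP0; have := row_mul j P (invmx P).
rewrite rowP0 mul0mx mulmxV// => /rowP/(_ j)/eqP.
by rewrite !mxE eqxx oner_eq0.
Qed.

Lemma mulmx_cols_eq0 (F : fieldType) m n (X : 'M[F]_(m, n)) (Q : 'M[F]_n) :
  Q \in unitmx -> (forall j, X *m col j Q = 0) -> X = 0.
Proof.
move=> Qunit XQ; rewrite -[X](mulmxK Qunit).
suff -> : X *m Q = 0 by rewrite mul0mx.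
by apply/matrixP => i j; have /colP/(_ i) := XQ j; rewrite colE mulmxA -colE !mxE.
Qed.

(** The operator [V -> V A - M V] is injective, hence bijective: if [V A = M V] and [A v = d v],
    then [(M - d) V v = 0], and [M - d] is invertible since [|d| >= 1]. *)
Lemma sylvester_solvable (R : realType) n1 n2 (A : 'M[R]_n1) (M : 'M[R]_n2)
    (B : 'M[R]_(n2, n1)) :
  stable M -> anti_stable A -> diagonalizable_over_C A ->
  exists V : 'M[R]_(n2, n1), V *m A - M *m V = B.
Proof.
move=> stM asA diagA; pose T := lin_mulmxr A - lin_mulmx M.
have TE V : mxvec V *m T = mxvec (V *m A - M *m V).
  by rewrite mulmxBr !mul_vec_lin linearB.
have /row_freeP[T' TT'] : row_free T.
  rewrite -kermx_eq0; apply/rowV0P => u /sub_kermxP.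
  rewrite -[u]vec_mxK; move: (vec_mx u) => V.
  rewrite TE => /(canRL mxvecK); rewrite linear0 => /eqP; rewrite subr_eq0 => /eqP VA.
  suff -> : V = 0 by rewrite linear0.
  apply: (@map_mx_inj _ _ (real_complex R)); rewrite map_mx0.
  have [Q [d [Qunit Aeig d1]]] := anti_stable_eigenbasis asA diagA.
  apply: (mulmx_cols_eq0 Qunit) => j.
  rewrite -[LHS]mul1mx -(mulVmx (stable_sub_scalar_unit stM (d1 j))) -mulmxA.
  rewrite mulmxBl mul_scalar_mx mulmxA -map_mxM -VA map_mxM -mulmxA Aeig.
  by rewrite scalemxAr subrr mulmx0.
exists (vec_mx (mxvec B *m T')).
by apply: (can_inj mxvecK); rewrite -TE vec_mxK -mulmxA (mulmx1C TT') mulmx1.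
Qed.

(** If [A v = d v], the entries of [C A^t v = d^t C v] are at least as large in modulus as those of
    [C v], so decay forces [C v = 0]. *)
Lemma anti_stable_cvg0_eq0 (R : realType) n p (A : 'M[R]_n) (C : 'M[R]_(p, n)) :
  anti_stable A -> diagonalizable_over_C A ->
  (forall (x : 'cV[R]_n) i,
     (fun t => (C *m iter t (mulmx A) x) i 0) @ \oo --> (0 : R)) ->
  C = 0.
Proof.
move=> asA diagA Cx; have [Q [d [Qunit Aeig d1]]] := anti_stable_eigenbasis asA diagA.
apply: (@map_mx_inj _ _ (real_complex R)); rewrite map_mx0.
apply: (mulmx_cols_eq0 Qunit) => j; apply/colP => i; rewrite [RHS]mxE.
set v := col j Q; set Cc := map_mx _ C.
have cvg_mode : (fun t => cmod ((Cc *m iter t (mulmx (complexify A)) v) i 0))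
    @ \oo --> (0 : R).
  (* The hypothesis covers real states only, so the complex mode is split into real and imaginary
     parts. *)
  pose rv := map_mx (@complex.Re R) v; pose iv := map_mx (@complex.Im R) v.
  have vE : v = complexify rv + 'i%C *: complexify iv.
    by apply/colP => k; rewrite !mxE; exact: complexE.
  have iterE (x : 'cV[R]_n) t :
      iter t (mulmx (complexify A)) (complexify x) = complexify (iter t (mulmx A) x).
    by elim: t => [|t IHt]//=; rewrite IHt /complexify map_mxM.
  apply: (@squeeze_cvgr _ _ _ _ (cst 0)
      (fun t => `|(C *m iter t (mulmx A) rv) i 0| + `|(C *m iter t (mulmx A) iv) i 0|)).
  - apply: nearW => t; rewrite cmod_ge0/=.
    have -> : iter t (mulmx (complexify A)) v =
        complexify (iter t (mulmx A) rv) + 'i%C *: complexify (iter t (mulmx A) iv).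
      rewrite vE -!iterE; elim: t => [|t IHt]//=.
      by rewrite IHt mulmxDr -scalemxAr.
    rewrite mulmxDr -scalemxAr -!map_mxM !mxE (le_trans (cmodD _ _))//.
    rewrite cmodM !cmod_real; suff -> : cmod 'i%C = 1 :> R by rewrite mul1r.
    by apply: (@complexI R); rewrite cmodE normc_def /= expr0n expr1n add0r sqrtr1.
  - exact: cvg_cst.
  - rewrite -[X in _ --> X](addr0 0).
    by apply: cvgD; apply/norm_cvg0P; exact: Cx.
apply: cmod0_eq; apply/eqP; rewrite eq_le cmod_ge0 andbT.
apply: (cvgr_to_ge cvg_mode); apply: nearW => t.
have -> : iter t (mulmx (complexify A)) v = d j ^+ t *: v.
  elim: t => [|t IHt] /=; first by rewrite expr0 scale1r.
  by rewrite IHt -scalemxAr Aeig scalerA exprSr.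
rewrite -scalemxAr [X in _ <= cmod X]mxE cmodM ler_peMl ?cmod_ge0// -cmod_ge1 normrX.
by rewrite exprn_ege1.
Qed.

(* k is tested on an eigenvector v of A with eigenvalue l: if k v <> 0, then V v
   is a nonzero multiple of (l - M)^-1 b, and b is arbitrary. *)
Lemma sylvester_rank1_annihilator (R : realType) n1 n2 p (A : 'M[R]_n1)
    (M : 'M[R]_n2) (G : 'M[R]_(p, n2)) (k : 'rV[R]_n1) :
  stable M -> anti_stable A -> diagonalizable_over_C A ->
  (forall (b : 'cV[R]_n2) V, V *m A - M *m V = b *m k -> G *m V = 0) ->
  G != 0 -> k = 0.
Proof.
move=> stM asA diagA annG /eqP G0.
have [Q [d [Qunit Aeig d1]]] := anti_stable_eigenbasis asA diagA.
apply: (@map_mx_inj _ _ (real_complex R)); rewrite map_mx0.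
apply: (mulmx_cols_eq0 Qunit) => j; apply/eqP/negPn/negP => kv0; case: G0.
apply: (@map_mx_inj _ _ (real_complex R)); rewrite map_mx0.
have Nunit := stable_sub_scalar_unit stM (d1 j).
set N := complexify M - _ in Nunit; set v := col j Q in kv0.
(* The columns of [invmx N] form a basis on which [G] is tested; taking [b = e_i] makes [V v] equal
   to [-(k v)] times the i-th column. *)
have Nunit' : invmx N \in unitmx by rewrite unitmx_inv.
apply: (mulmx_cols_eq0 Nunit') => i; rewrite colE.
have [V VE] := sylvester_solvable (delta_mx i 0 *m k) stM asA diagA.
have NV : N *m (complexify V *m v) = - (delta_mx i 0 *m (complexify k *m v)).
  have := congr1 (fun X => complexify X *m v) VE.
  rewrite /complexify map_mxB !map_mxM map_delta_mx -!mulmxA => <-.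
  by rewrite !mulmxBl mul_scalar_mx -!mulmxA Aeig -scalemxAr opprB.
have GV : complexify G *m (complexify V *m v) = 0.
  by rewrite mulmxA -map_mxM (annG _ _ VE) map_mx0 mul0mx.
move: GV; rewrite -[_ *m v](mulKmx Nunit) NV.
rewrite [complexify k *m v]mx11_scalar mul_mx_scalar !mulmxN -!scalemxAr.
move/eqP; rewrite oppr_eq0 scaler_eq0 => /orP[/eqP kv|/eqP//].
by case/negP: kv0; rewrite [complexify k *m v]mx11_scalar kv raddf0.
Qed.

(** * Output regulation through a Sylvester equation *)

Lemma cvg0_mulmxl (R : realType) n p (G : 'M[R]_(p, n)) (e : nat -> 'cV[R]_n) :
  (forall j, (fun t => e t j 0) @ \oo --> (0 : R)) ->
  (fun t => G *m e t) @ \oo --> (0 : 'cV[R]_p).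
Proof.
move=> e0; apply/cvg_col0P => i.
have -> : (fun t => (G *m e t) i 0) = fun t => \sum_j G i j * e t j 0.
  by apply/funext => t; rewrite mxE.
rewrite -[X in _ --> X](_ : \sum_j G i j * 0 = 0); last first.
  by rewrite big1// => j _; rewrite mulr0.
apply: (cvg_big add_continuous) => j _; apply: cvgMr; exact: e0.
Qed.

Section output_regulation.
Variables (R : realType) (n1 n2 m p : nat).
Variables (A1 : 'M[R]_n1) (A3 : 'M[R]_(n2, n1)) (A2 : 'M[R]_n2) (B2 : 'M[R]_(n2, m)).
Variables (D1 : 'M[R]_(p, n1)) (D2 : 'M[R]_(p, n2)) (E : 'M[R]_(p, m)).
Variables (K1 : 'M[R]_(m, n1)) (K2 : 'M[R]_(m, n2)) (V : 'M[R]_(n2, n1)).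
Hypothesis regV : V *m A1 - (A2 + B2 *m K2) *m V = A3 + B2 *m K1.

Lemma sylvester_output_regulated :
  endo_stable A2 B2 K2 ->
  D1 + E *m K1 + (D2 + E *m K2) *m V = 0 ->
  output_regulated A1 A3 D1 D2 E A2 B2 K1 K2.
Proof.
move=> st outV x1 x2 traj; pose e t := x2 t - V *m x1 t.
have erec t : e t.+1 = (A2 + B2 *m K2) *m e t.
  have [x1t x2t] := traj t.
  rewrite /e x1t x2t -regV mulmxBr !mulmxBl !mulmxA.
  by rewrite addrAC [X in X + _]addrAC subrr add0r addrC.
have -> : (fun t => (D1 + E *m K1) *m x1 t + (D2 + E *m K2) *m x2 t) =
    fun t => (D2 + E *m K2) *m e t.
  apply/funext => t; rewrite mulmxBr mulmxA addrC; congr (_ + _).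
  by apply/eqP; rewrite -addr_eq0 -mulmxDl outV mul0mx.
by apply: cvg0_mulmxl; exact: stable_trajectory_cvg0 st erec.
Qed.

(* Starting on the invariant subspace x2 = V x1 keeps the trajectory on it. *)
Lemma output_regulated_sylvester :
  anti_stable A1 -> diagonalizable_over_C A1 ->
  output_regulated A1 A3 D1 D2 E A2 B2 K1 K2 ->
  D1 + E *m K1 + (D2 + E *m K2) *m V = 0.
Proof.
move=> asA diagA outreg; apply: (anti_stable_cvg0_eq0 asA diagA) => x i.
pose x1 t := iter t (mulmx A1) x.
have /outreg/cvg_col0P/(_ i) :
    controlled_trajectory A1 A3 A2 B2 K1 K2 x1 (fun t => V *m x1 t).
  move=> t; split=> //; rewrite -regV mulmxBl -!mulmxA subrK.
  by rewrite /x1 iterS.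
rewrite [X in X @ \oo --> _](_ : _ =
  fun t => ((D1 + E *m K1 + (D2 + E *m K2) *m V) *m x1 t) i 0)//.
by apply/funext => t; rewrite mulmxA -mulmxDl.
Qed.

End output_regulation.

(** * Compatible systems and necessity of the conditions *)

Lemma compatible_systemsE (R : realType) (n1 n2 m tau : nat)
    (A3 : 'M[R]_(n2, n1)) (U : 'M[R]_(m, tau)) (X1 : 'M[R]_(n1, tau))
    (X2 : 'M[R]_(n2, tau.+1)) (S : 'M[R]_n2 * 'M[R]_(n2, m)) :
  compatible_systems A3 U X1 X2 S ->
  future X2 - A3 *m X1 = S.1 *m past X2 + S.2 *m U.
Proof. by move=> ->; rewrite addrAC addrK. Qed.

Section necessity.
Variables (R : realType) (n1 n2 m p tau : nat).
Variables (A1 : 'M[R]_n1) (A3 : 'M[R]_(n2, n1)).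
Variables (D1 : 'M[R]_(p, n1)) (D2 : 'M[R]_(p, n2)) (E : 'M[R]_(p, m)).
Variables (U : 'M[R]_(m, tau)) (X1 : 'M[R]_(n1, tau)) (X2 : 'M[R]_(n2, tau.+1)).
Variables (A2s : 'M[R]_n2) (B2s : 'M[R]_(n2, m)).
Hypothesis true_compatible : compatible_systems A3 U X1 X2 (A2s, B2s).
Variables (K1 : 'M[R]_(m, n1)) (K2 : 'M[R]_(m, n2)).

(** Rows [(a, h)] in the left kernel of the stacked data are invisible in the samples. *)
Lemma compatible_perturbation (b : 'cV[R]_n2) (a : 'rV[R]_n2) (h : 'rV[R]_m) :
  a *m past X2 + h *m U = 0 ->
  compatible_systems A3 U X1 X2 (A2s + b *m a, B2s + b *m h).
Proof.
have := true_compatible; rewrite /compatible_systems /= => trueE aX.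
rewrite trueE !mulmxDl -!mulmxA -!addrA; congr (_ + _).
rewrite addrCA; congr (_ + _); rewrite addrCA -[LHS]addr0; congr (_ + _).
by rewrite -mulmxDr aX mulmx0.
Qed.

(* The perturbation s g^T (a, h), with g = a + h K2, is compatible for every s and
   shifts the trace of the closed loop by s |g|^2; stability bounds the trace. *)
Lemma stabilizing_gain_image :
  (forall S, compatible_systems A3 U X1 X2 S -> endo_stable S.1 S.2 K2) ->
  exists2 Xd, past X2 *m Xd = 1%:M & U *m Xd = K2.
Proof.
(* Stacking makes a single [Xd] serve both equations; it remains to show [a + h K2 = 0] for every
   left annihilator [(a, h)] of the data. *)
move=> stab; suff [Xd] : exists Xd, col_mx 1%:M K2 = col_mx (past X2) U *m Xd.
  by rewrite mul_col_mx => /eq_col_mx[PXd UXd]; exists Xd.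
apply: mulmx_solvable => ah; rewrite -[ah]hsubmxK.
move: (lsubmx ah) (rsubmx ah) => a h; rewrite !mul_row_col mulmx1 => aX.
set g := a + h *m K2; pose q := \tr (g^T *m g); set M := A2s + B2s *m K2.
have bound (s : R) : `|\tr M + s * q| <= n2%:R.
  have /stab := compatible_perturbation (s *: g^T) aX.
  rewrite /endo_stable /= mulmxDl addrACA -!mulmxA -mulmxDr -/g -/M.
  by move=> /stable_norm_trace; rewrite mxtraceD -scalemxAl mxtraceZ.
have qE : q = \sum_j g 0 j ^+ 2.
  rewrite /q mxtrace_mulC /mxtrace big_ord1 mxE.
  by apply: eq_bigr => j _; rewrite [X in _ * X]mxE -expr2.
have q0 : q = 0.
  apply/eqP/negPn/negP => q_neq0.
  (* This [s] brings the trace to [n2 + 1], above the bound. *)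
  have := bound ((n2%:R + 1 - \tr M) / q).
  rewrite divfK// addrC subrK ger0_norm ?addr_ge0//; lra.
apply/rowP => j; rewrite [RHS]mxE; apply/eqP; rewrite -sqrf_eq0.
have /eqP := q0; rewrite qE psumr_eq0 => [/allP/(_ j)|k _]; last exact: sqr_ge0.
by apply; rewrite mem_index_enum.
Qed.

Lemma regulator_conditions :
  anti_stable A1 -> diagonalizable_over_C A1 ->
  (forall S, compatible_systems A3 U X1 X2 S -> regulator A1 A3 D1 D2 E K1 K2 S) ->
  (exists Xd, condition1_with A3 D1 D2 E U X1 X2 Xd) \/
  (exists Xd W, condition2_with A1 A3 D1 D2 E U X1 X2 Xd W).
Proof.
move=> asA diagA reg.
have [Xd PXd UXd] := stabilizing_gain_image (fun S cS => (reg S cS).1).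
have rankP : full_row_rank (past X2) by apply/eqP/row_freeP; exists Xd.
have /= FE := compatible_systemsE true_compatible.
have FXd : (future X2 - A3 *m X1) *m Xd = A2s + B2s *m K2.
  by rewrite FE mulmxDl -!mulmxA PXd UXd mulmx1.
have [stM outreg] := reg _ true_compatible; rewrite /endo_stable /= in stM outreg.
set M := A2s + B2s *m K2 in FXd stM.
have [V VE] := sylvester_solvable (A3 + B2s *m K1) stM asA diagA.
have outV := output_regulated_sylvester VE asA diagA outreg.
set G := D2 + E *m K2 in outV.
have [G0|G_neq0] := eqVneq G 0.
  left; exists Xd; split; rewrite /Defs.right_inverse ?FXd//.
    by rewrite -mulmxA UXd.
  move=> _ [v _ <-]; exists (- (K1 *m v)) => //.
  rewrite mulmxN mulmxA; apply/eqP; rewrite eq_sym -addr_eq0 -mulmxDl.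
  by move: outV; rewrite G0 mul0mx addr0 => ->; rewrite mul0mx.
right; have [Y K1E] : exists Y, K1 = (U - K2 *m past X2) *m Y.
  apply: mulmx_solvable => h hU.
  apply: (sylvester_rank1_annihilator stM asA diagA _ G_neq0) => b V' V'E.
  (* With [a = - h K2] the closed loop stays equal to [M], so [V + V'] solves the perturbed
     Sylvester equation, and subtracting the two output equations leaves [G V' = 0]. *)
  have hX : - (h *m K2) *m past X2 + h *m U = 0.
    by rewrite mulNmx -mulmxA addrC -mulmxBr.
  have /reg[_ /= outreg'] := compatible_perturbation b hX.
  have VV'E : (V + V') *m A1 - (A2s + b *m - (h *m K2) + (B2s + b *m h) *m K2) *m (V + V')
      = A3 + (B2s + b *m h) *m K1.
    have -> : A2s + b *m - (h *m K2) + (B2s + b *m h) *m K2 = M.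
      by rewrite mulmxN mulmxDl mulmxA addrACA addNr addr0.
    by rewrite mulmxDl mulmxDr opprD addrACA VE V'E mulmxDl -mulmxA addrA.
  have := output_regulated_sylvester VV'E asA diagA outreg'.
  by rewrite mulmxDr addrA outV add0r.
(* The second term lies in the kernel of [past X2], and [U] maps it to [K1]. *)
pose W := Xd *m V + (Y - Xd *m past X2 *m Y).
have PW : past X2 *m W = V.
  by rewrite mulmxDr mulmxBr !mulmxA PXd !mul1mx subrr addr0.
have UW : U *m W = K2 *m V + K1.
  by rewrite mulmxDr mulmxBr !mulmxA UXd K1E mulmxBl.
exists Xd, W; split; rewrite /Defs.right_inverse ?FXd//.
  rewrite FE PW mulmxDl -!mulmxA PW UW mulmxDr addrA mulmxA -mulmxDl.
  by rewrite opprD addrA VE addrK.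
rewrite mulmxDl -!mulmxA PW UW mulmxDr -outV /G mulmxDl mulmxA -addrA.
by congr (_ + _); rewrite addrA addrC.
Qed.

End necessity.

(** * Sufficiency and the explicit regulators *)

Section sufficiency.
Variables (R : realType) (n1 n2 m p tau : nat).
Variables (A1 : 'M[R]_n1) (A3 : 'M[R]_(n2, n1)).
Variables (D1 : 'M[R]_(p, n1)) (D2 : 'M[R]_(p, n2)) (E : 'M[R]_(p, m)).
Variables (U : 'M[R]_(m, tau)) (X1 : 'M[R]_(n1, tau)) (X2 : 'M[R]_(n2, tau.+1)).
Variable Xd : 'M[R]_(tau, n2).

(** Multiplying the data equation by [Xd] on the right eliminates the unknown system. *)
Lemma compatible_closed_loop (S : 'M[R]_n2 * 'M[R]_(n2, m)) :
  Defs.right_inverse (past X2) Xd ->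
  compatible_systems A3 U X1 X2 S ->
  S.1 + S.2 *m (U *m Xd) = (future X2 - A3 *m X1) *m Xd.
Proof.
by move=> PXd /compatible_systemsE->; rewrite mulmxDl -!mulmxA PXd mulmx1.
Qed.

Lemma condition1_regulator K1 S :
  condition1_with A3 D1 D2 E U X1 X2 Xd -> D1 + E *m K1 = 0 ->
  compatible_systems A3 U X1 X2 S -> regulator A1 A3 D1 D2 E K1 (U *m Xd) S.
Proof.
move=> [_ PXd stF DE _] DK cS; split.
  by rewrite /endo_stable (compatible_closed_loop PXd cS).
(* The output vanishes identically, whatever the trajectory. *)
move=> x1 x2 _.
have -> : (fun t => (D1 + E *m K1) *m x1 t + (D2 + E *m (U *m Xd)) *m x2 t) = cst 0.
  by apply/funext => t; rewrite DK mulmxA DE !mul0mx addr0.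
exact: cvg_cst.
Qed.

Lemma condition2_regulator W S :
  condition2_with A1 A3 D1 D2 E U X1 X2 Xd W ->
  compatible_systems A3 U X1 X2 S ->
  regulator A1 A3 D1 D2 E (U *m (1%:M - Xd *m past X2) *m W) (U *m Xd) S.
Proof.
move=> [_ PXd stF sylW outW] cS.
have stS : endo_stable S.1 S.2 (U *m Xd).
  by rewrite /endo_stable (compatible_closed_loop PXd cS).
(* With [V = past X2 *m W] the gain is [U W - K2 V], so that on [x2 = V x1] the input is
   [U W x1]. *)
have K1E : U *m (1%:M - Xd *m past X2) *m W = U *m W - U *m Xd *m (past X2 *m W).
  by rewrite mulmxBr mulmx1 mulmxBl !mulmxA.
split=> //; apply: (sylvester_output_regulated (V := past X2 *m W)) => //.
  rewrite -sylW K1E (compatible_systemsE cS) !(mulmxDl, mulmxBr) opprD !mulmxA.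
  by rewrite opprD !addrA subrK.
rewrite K1E -outW mulmxBr !mulmxDl !mulmxA -addrA.
by congr (_ + _); rewrite addrACA addNr addr0 addrC.
Qed.

(** Condition 1 only compares images; testing the inclusion on the columns of [D1] yields the gain
    needed for informativity. *)
Lemma condition1_feedforward : condition1_with A3 D1 D2 E U X1 X2 Xd ->
  exists K1, D1 + E *m K1 = 0.
Proof.
move=> [_ _ _ _ imDE].
have [Y D1E] : exists Y, D1 = E *m Y.
  apply: mulmx_solvable => h hE; apply/row_matrixP => i.
  apply/rowP => j; rewrite row0 row_mul !mxE.
  have [|w _ wE] := imDE (col j D1); first by exists (delta_mx j 0); rewrite // -colE.
  have : (h *m col j D1) i 0 = 0 by rewrite -wE mulmxA hE mul0mx mxE.
  by rewrite mxE => hD; rewrite -[RHS]hD; apply: eq_bigr => k _; rewrite !mxE.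
by exists (- Y); rewrite mulmxN -D1E subrr.
Qed.

End sufficiency.

Theorem theorem8 (R : realType) (n1 n2 m p tau : nat)
    (A1 : 'M[R]_n1) (A3 : 'M[R]_(n2, n1))
    (D1 : 'M[R]_(p, n1)) (D2 : 'M[R]_(p, n2)) (E : 'M[R]_(p, m))
    (U : 'M[R]_(m, tau)) (X1 : 'M[R]_(n1, tau)) (X2 : 'M[R]_(n2, tau.+1))
    (A2s : 'M[R]_n2) (B2s : 'M[R]_(n2, m))
    (tau_gt0 : (0 < tau)%N)
    (true_compatible : compatible_systems A3 U X1 X2 (A2s, B2s))
    (A1_anti_stable : anti_stable A1)
    (A1_diagonalizable : diagonalizable_over_C A1) :
  (informative A1 A3 D1 D2 E U X1 X2 <->
     (exists Xd : 'M[R]_(tau, n2), condition1_with A3 D1 D2 E U X1 X2 Xd) \/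
     (exists (Xd : 'M[R]_(tau, n2)) (W : 'M[R]_(tau, n1)),
        condition2_with A1 A3 D1 D2 E U X1 X2 Xd W))
  /\
  (forall Xd : 'M[R]_(tau, n2),
     condition1_with A3 D1 D2 E U X1 X2 Xd ->
     forall K1 : 'M[R]_(m, n1), D1 + E *m K1 = 0 ->
     forall S : 'M[R]_n2 * 'M[R]_(n2, m),
       compatible_systems A3 U X1 X2 S ->
       regulator A1 A3 D1 D2 E K1 (U *m Xd) S)
  /\
  (forall (Xd : 'M[R]_(tau, n2)) (W : 'M[R]_(tau, n1)),
     condition2_with A1 A3 D1 D2 E U X1 X2 Xd W ->
     forall S : 'M[R]_n2 * 'M[R]_(n2, m),
       compatible_systems A3 U X1 X2 S ->
       regulator A1 A3 D1 D2 E (U *m (1%:M - Xd *m past X2) *m W) (U *m Xd) S).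
Proof.
split; last first.
  split=> [Xd cond1 K1 DK S|Xd W cond2 S]; first exact: condition1_regulator.
  exact: condition2_regulator.
split=> [[K1 [K2 reg]]|[[Xd cond1]|[Xd [W cond2]]]].
- exact: (regulator_conditions true_compatible A1_anti_stable A1_diagonalizable reg).
- have [K1 DK] := condition1_feedforward cond1.
  by exists K1, (U *m Xd) => S; exact: condition1_regulator.
- exists (U *m (1%:M - Xd *m past X2) *m W), (U *m Xd) => S.
  exact: condition2_regulator cond2.
Qed.
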